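(* Let $\{\Lambda_{x,j}\in\mathcal{L}(\mathcal{H},\mathcal{K}_{x,j}): x\in\mathcal{X}, j\in J\}$ be a semi-continuous $g$-frame for a Hilbert space $\mathcal{H}$ with respect to a measure space $(\mathcal{X},\mu)$, and let $\{\tilde\Lambda_{x,j}: x\in\mathcal{X},j\in J\}$ be its canonical dual frame. Then for any $\lambda\in[0,1]$, every measurable $\mathcal{X}_1\subset\mathcal{X}$ (with $\mathcal{X}_1^c=\mathcal{X}\setminus\mathcal{X}_1$) and every $f\in\mathcal{H}$, $$\int_{\mathcal{X}}\sum_{j\in J}\|\tilde\Lambda_{x,j}S_{\mathcal{X}_1}f\|^2d\mu(x)+\int_{\mathcal{X}_1^c}\sum_{j\in J}\|\Lambda_{x,j}f\|^2d\mu(x)=\int_{\mathcal{X}}\sum_{j\in J}\|\tilde\Lambda_{x,j}S_{\mathcal{X}_1^c}f\|^2d\mu(x)+\int_{\mathcal{X}_1}\sum_{j\in J}\|\Lambda_{x,j}f\|^2d\mu(x)$$ $$\ge(2\lambda-\lambda^2)\int_{\mathcal{X}_1}\sum_{j\in J}\|\Lambda_{x,j}f\|^2d\mu(x)+(1-\lambda^2)\int_{\mathcal{X}_1^c}\sum_{j\in J}\|\Lambda_{x,j}f\|^2d\mu(x).$$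
   Context: $\mathcal{H},\mathcal{K}$ are Hilbert spaces, $J$ is a countable index set, $(\mathcal{X},\mu)$ is a measure space with positive measure, $\{\mathcal{K}_{x,j}\}_{x\in\mathcal{X},j\in J}$ is a family of closed subspaces of $\mathcal{K}$, and $\mathcal{L}(\mathcal{H},\mathcal{K}_{x,j})$ is the space of bounded linear operators. A family $\{\Lambda_{x,j}\in\mathcal{L}(\mathcal{H},\mathcal{K}_{x,j})\}$ is a semi-continuous $g$-frame for $\mathcal{H}$ with respect to $(\mathcal{X},\mu)$ if for every $f\in\mathcal{H}$ and $j\in J$ the function $x\mapsto\Lambda_{x,j}(f)$ is measurable on $\mathcal{X}$, and there are constants $A,B>0$ with $A\|f\|^2\le\int_{\mathcal{X}}\sum_{j\in J}\|\Lambda_{x,j}(f)\|^2d\mu(x)\le B\|f\|^2$ for all $f\in\mathcal{H}$. For measurable $\mathcal{X}_1\subset\mathcal{X}$, $S_{\mathcal{X}_1}f=\int_{\mathcal{X}_1}\sum_{j\in J}\Lambda_{x,j}^*\Lambda_{x,j}f\,d\mu(x)$, understood weakly, i.e. $\langle S_{\mathcal{X}_1}f,g\rangle=\int_{\mathcal{X}_1}\sum_j\langle\Lambda_{x,j}f,\Lambda_{x,j}g\rangle\,d\mu(x)$ for all $g\in\mathcal{H}$. The frame operator is $S=S_{\mathcal{X}}$, which is bounded, invertible, self-adjoint and positive. The canonical dual frame is $\tilde\Lambda_{x,j}=\Lambda_{x,j}S^{-1}$. *)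

(* Defs.v *)
From HB Require Import structures.
From mathcomp Require Import all_boot all_order all_algebra.
From mathcomp Require Import all_classical all_reals all_analysis.
From mathcomp Require Import complex.

Set Implicit Arguments.
Unset Strict Implicit.
Unset Printing Implicit Defensive.

Import Order.TTheory GRing.Theory Num.Theory.
Import numFieldNormedType.Exports.

Local Open Scope classical_set_scope.
Local Open Scope ring_scope.

(* Hilbert spaces may be real or complex: everything below is parametrized by
   the kind of scalars. *)
Variant scalar_kind := RealScalars | ComplexScalars.

Definition scalar_field (R : realType) (k : scalar_kind) : numFieldType :=
  match k with RealScalars => R | ComplexScalars => R[i] end.

Section scalar.
Variables (R : realType) (k : scalar_kind).

Definition sconj : {rmorphism scalar_field R k -> scalar_field R k} :=
  match k return {rmorphism scalar_field R k -> scalar_field R k} with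
  | RealScalars => idfun
  | ComplexScalars => @Num.conj R[i]
  end.

Definition sRe : scalar_field R k -> R :=
  match k return scalar_field R k -> R with
  | RealScalars => id
  | ComplexScalars => @complex.Re R
  end.

Definition sIm : scalar_field R k -> R :=
  match k return scalar_field R k -> R with
  | RealScalars => fun=> 0
  | ComplexScalars => @complex.Im R
  end.

(* The scalar with given real and imaginary parts; over the reals the second
   argument is only ever 0. *)
Definition sMk : R -> R -> scalar_field R k :=
  match k return R -> R -> scalar_field R k with
  | RealScalars => fun a _ => a
  | ComplexScalars => fun a b => @Complex R a b
  end.

End scalar.

(* The inner product is linear in its first argument. *)
HB.mixin Record NormedModule_isHilbert (R : realType) (k : scalar_kind) V
    of CompleteNormedModule (scalar_field R k) V := {
  inner : {dot V for sconj R k} ;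
  inner_norm : forall u : V, inner u u = `|u| ^+ 2
}.

#[short(type="hilbertType")]
HB.structure Definition Hilbert (R : realType) (k : scalar_kind) :=
  {V of CompleteNormedModule (scalar_field R k) V
   & NormedModule_isHilbert R k V}.

(* mathcomp's norm takes its values in the field of scalars; this is the same
   norm as an element of R. *)
Definition hnorm (R : realType) (k : scalar_kind) (V : hilbertType R k)
    (v : V) : R := sRe `|v|.

Definition closed_subspace (R : realType) (k : scalar_kind)
    (V : hilbertType R k) (W : set V) : Prop :=
  closed W /\ submod_closed [pred v | v \in W].

Definition bounded_operator (R : realType) (k : scalar_kind)
    (V W : hilbertType R k) (T : {linear V -> W}) : Prop :=
  exists M : R, forall v, hnorm (T v) <= M * hnorm v.

(* The (unordered, absolutely convergent) sum of a scalar family; the value is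
   irrelevant when the family is not absolutely summable. *)
Definition rsum (R : realType) (J : countType) (a : J -> R) : R :=
  fine (\esum_(j in [set: J]) (a^\+ j)%:E)
  - fine (\esum_(j in [set: J]) (a^\- j)%:E).

Definition ssum (R : realType) (k : scalar_kind) (J : countType)
    (a : J -> scalar_field R k) : scalar_field R k :=
  sMk k (rsum (fun j => sRe (a j))) (rsum (fun j => sIm (a j))).

Definition sintegral d (X : measurableType d) (R : realType)
    (mu : {measure set X -> \bar R}) (k : scalar_kind) (A : set X)
    (h : X -> scalar_field R k) : scalar_field R k :=
  sMk k (\int[mu]_(x in A) sRe (h x))%R (\int[mu]_(x in A) sIm (h x))%R.

Section gframe.
Context d (X : measurableType d) (R : realType).
Variables (mu : {measure set X -> \bar R}) (k : scalar_kind).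
Variables (H K : hilbertType R k) (J : countType).
Implicit Types (L : X -> J -> {linear H -> K}) (A : set X).

(* An element of L(H, K_(x,j)) is a bounded linear map into K whose range lies in
   the subspace Ksub x j; x |-> L x j f is Borel measurable for the norm topology
   of K. *)
Record semicontinuous_gframe (Ksub : X -> J -> set K) L : Prop := {
  gframe_range : forall x j f, Ksub x j (L x j f) ;
  gframe_bounded : forall x j, bounded_operator (L x j) ;
  gframe_measurable : forall f j,
    measurable_fun [set: X]
      ((fun x => L x j f) : X -> g_sigma_algebraType (@open K)) ;
  gframe_bounds : exists a b : R, [/\ 0 < a, 0 < b & forall f : H,
    ((a * hnorm f ^+ 2)%:E
      <= (\int[mu]_x \esum_(j in [set: J]) (hnorm (L x j f) ^+ 2)%:E)
      <= (b * hnorm f ^+ 2)%:E)%E]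
}.

Definition gframe_form L A (f g : H) : scalar_field R k :=
  sintegral mu A (fun x => ssum (fun j => inner (L x j f) (L x j g))).

(* S_A, understood weakly: S_A f is the unique vector representing the bounded
   antilinear form gframe_form L A f. The default value 0 is not used when L is
   a frame. *)
Definition gframe_op L A (f : H) : H :=
  xget 0 [set h : H | forall g, inner h g = gframe_form L A f g].

Definition gframe_inv L : H -> H := 'pinv_(fun=> 0) [set: H] (gframe_op L setT).

Definition canonical_dual L (x : X) (j : J) : H -> K :=
  L x j \o gframe_inv L.

End gframe.

(* Main.v *)
(* Over the underlying real Hilbert space, the energy
   Phi_A(u) = \int_A \sum_j |L_(x,j) u|^2 is a bounded quadratic form, coercive
   for A = X, and its polarization P_A satisfies <S_A f, g> = P_A(f, g).
   Minimizing u |-> P(u, u) - 2 l(u) for a coercive form P represents a bounded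
   functional l; this yields both the existence of S_A f (P = inner product) and
   its membership in the range of S (P = P_X).  Hence u_i := S^-1 S_(X_i) f, for
   X_1 and X_2 := X \ X_1, is characterized by P_X(u_i, g) = P_(X_i)(f, g).
   Summing over i gives P_X(u_1 + u_2, g) = P_X(f, g), which yields the identity,
   and the inequality is Phi_X(u_2 - (1 - lambda) f) >= 0 expanded. *)
Require Import Defs.
From mathcomp Require Import all_boot all_order all_algebra.
From mathcomp Require Import all_classical all_reals all_analysis.
From mathcomp Require Import measurable_realfun complex ring lra.

Set Implicit Arguments.
Unset Strict Implicit.
Unset Printing Implicit Defensive.

Import Order.TTheory GRing.Theory Num.Theory.
Import numFieldNormedType.Exports.

Local Open Scope classical_set_scope.
Local Open Scope ring_scope.

(** * Real and imaginary parts, uniformly over both kinds of scalars *)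

Section scalars.
Variables (R : realType) (k : scalar_kind).
Local Notation F := (scalar_field R k).
Implicit Types z w : F.

Lemma sReD z w : sRe (z + w) = sRe z + sRe w.
Proof. by case: k z w => //= -[a b] [c e]. Qed.

Lemma sRe0 : sRe (0 : F) = 0.
Proof. by case: k. Qed.

Lemma sRe_conj z : sRe (sconj R k z) = sRe z.
Proof. by case: k z => //= -[a b]. Qed.

Lemma sMkK z : sMk k (sRe z) (sIm z) = z.
Proof. by case: k z => //= -[a b]. Qed.

Lemma sReK a b : sRe (sMk (R := R) k a b) = a.
Proof. by case: k. Qed.

Lemma sReZ a z : sRe (sMk k a 0 * z) = a * sRe z.
Proof. by case: k z => //= -[b c]; rewrite /= mul0r subr0. Qed.

(* Over the real scalars [sMk k 0 1] is [0], which is consistent with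
   [sIm = 0]. *)
Lemma sIm_sRe z : sIm z = sRe (sconj R k (sMk k 0 1) * z).
Proof.
case: k z => /= [z|[a b]]; first by rewrite mul0r.
by rewrite /= mul0r mulN1r opprK add0r.
Qed.

Lemma sRe_le z w : z <= w -> sRe z <= sRe w.
Proof. by case: k z w => //= -[a b] [c e] /=; rewrite lecE => /andP[]. Qed.

Lemma sRe_lt z w : z < w -> sRe z < sRe w.
Proof. by case: k z w => //= -[a b] [c e] /=; rewrite ltcE => /andP[]. Qed.

(** Comparable complex numbers have equal imaginary parts. This lets norms and radii be handled as
    elements of [R]. *)
Lemma ge0_sMk z : 0 <= z -> z = sMk k (sRe z) 0.
Proof. by case: k z => //= -[a b] /=; rewrite lecE /= => /andP[/eqP->]. Qed.

Lemma sMk_lt a b : (sMk k a 0 < sMk (R := R) k b 0) = (a < b).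
Proof. by case: k => //=; rewrite ltcE /= eqxx. Qed.

Lemma sMkM a b : sMk k (a * b) 0 = sMk k a 0 * sMk (R := R) k b 0.
Proof.
case: k => //=; apply/eqP.
by rewrite eq_complex /= !(mulr0, mul0r, subr0, addr0) !eqxx.
Qed.

End scalars.

(** * The underlying real Hilbert space *)

Section hilbert.
Variables (R : realType) (k : scalar_kind) (V : hilbertType R k).
Implicit Types u v w : V.

Definition rdot u v : R := sRe (inner u v).

Definition rscale (t : R) u : V := sMk k t 0 *: u.

Lemma rdotC u v : rdot u v = rdot v u.
Proof. by rewrite /rdot hermC expr0 mul1r sRe_conj. Qed.

Lemma rdotDl u v w : rdot (u + v) w = rdot u w + rdot v w.
Proof. by rewrite /rdot linearDl sReD. Qed.

Lemma rdotZl t u w : rdot (rscale t u) w = t * rdot u w.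
Proof. by rewrite /rdot /rscale linearZl_LR /= sReZ. Qed.

Lemma hnorm_ge0 u : 0 <= hnorm u.
Proof. by rewrite -(sRe0 R k) sRe_le. Qed.

Lemma normE u : `|u| = sMk k (hnorm u) 0.
Proof. exact: ge0_sMk. Qed.

Lemma rdot_hnorm u : rdot u u = hnorm u ^+ 2.
Proof. by rewrite /rdot inner_norm normE expr2 -sMkM sReK. Qed.

Lemma hnorm_eq0 u : hnorm u = 0 -> u = 0.
Proof.
by move=> u0; apply/normr0_eq0; rewrite normE u0 -{1}(sRe0 R k) -ge0_sMk.
Qed.

Lemma hnorm_triangle u v : hnorm (u + v) <= hnorm u + hnorm v.
Proof. by rewrite /hnorm -sReD sRe_le// ler_normD. Qed.

(** By the triangle inequality the ball around [v] of radius [hnorm v - r] stays in the set. Used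
    for the measurability of [hnorm]. *)
Lemma open_hnorm_gt (r : R) : open [set v : V | r < hnorm v].
Proof.
rewrite openE => v /= rv; apply/nbhs_ballP.
exists (sMk k (hnorm v - r) 0).
  by rewrite /= (@ge0_sMk R k 0)// sRe0 sMk_lt subr_gt0.
move=> w; rewrite -ball_normE /ball_ /= normE sMk_lt => vw.
have := hnorm_triangle (v - w) w; rewrite subrK; lra.
Qed.

(** Antilinearity in the second argument absorbs the conjugate of $i$ from [sIm_sRe]. Hence [rdot]
    determines the whole inner product. *)
Lemma sIm_inner u v : sIm (inner u v) = rdot u (sMk k 0 1 *: v).
Proof. by rewrite sIm_sRe /rdot linearZr_LR. Qed.

Lemma innerE u v :
  inner u v = sMk k (rdot u v) (rdot u (sMk k 0 1 *: v)).
Proof. by rewrite -sIm_inner sMkK. Qed.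

End hilbert.

(** If [c] is positive, evaluate at the minimizer $t = -b/c$; if [c] is 0, an affine function
    bounded below is constant, so [b] is 0. *)
Lemma quad_ge0_discr (R : realFieldType) (a b c : R) :
  (forall t, 0 <= a + 2 * t * b + t ^+ 2 * c) -> 0 <= c -> b ^+ 2 <= a * c.
Proof.
move=> q; rewrite le_eqVlt => /predU1P[c0|c0].
  rewrite -c0 mulr0; have [->|b0] := eqVneq b 0; first by rewrite expr0n.
  (* At this point the affine function takes the value $-1$. *)
  have := q (- (a + 1) / (2 * b)); rewrite -c0 mulr0 addr0.
  rewrite (_ : 2 * _ * b = - (a + 1)); last by field.
  by move=> ?; lra.
have := q (- b / c); rewrite -(ler_pM2r c0) mul0r.
rewrite (_ : (_ + _ + _) * c = a * c - b ^+ 2) ?subr_ge0//.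
by field; rewrite gt_eqF.
Qed.

(** * Positive semidefinite real forms and the representation of functionals *)

Section real_forms.
Variables (R : realType) (k : scalar_kind) (V : hilbertType R k).
Implicit Types f g u v w : V.

(** Only semidefinite, so as to cover the forms $P_A$ of arbitrary measurable parts $A$; coercivity
    is a separate hypothesis where it matters. *)
Record real_form (P : V -> V -> R) : Prop := {
  real_formC : forall u v, P u v = P v u ;
  real_formDl : forall u v w, P (u + v) w = P u w + P v w ;
  real_formZl : forall t u v, P (rscale t u) v = t * P u v ;
  real_form_ge0 : forall u, 0 <= P u u
}.

Lemma real_form_rdot : real_form (@rdot R k V).
Proof.
split; [exact: rdotC|exact: rdotDl|exact: rdotZl|].
by move=> u; rewrite rdot_hnorm sqr_ge0.
Qed.

Lemma rscaleN1 u : rscale (-1) u = - u.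
Proof.
rewrite /rscale (_ : sMk k (-1) 0 = -1) ?scaleN1r//.
by case: k => //=; apply/eqP; rewrite eq_complex /= oppr0 !eqxx.
Qed.

Variables (P : V -> V -> R) (Pform : real_form P).

Let PC := real_formC Pform.
Let PDl := real_formDl Pform.
Let PZl := real_formZl Pform.
Let P0 := real_form_ge0 Pform.

Lemma real_formDr u v w : P u (v + w) = P u v + P u w.
Proof. by rewrite PC PDl PC [P w u]PC. Qed.

Lemma real_formZr t u v : P u (rscale t v) = t * P u v.
Proof. by rewrite PC PZl PC. Qed.

Lemma real_formBl u v w : P (u - v) w = P u w - P v w.
Proof. by rewrite -rscaleN1 PDl PZl mulN1r. Qed.

Lemma real_form_line t u v :
  P (u + rscale t v) (u + rscale t v) = P u u + 2 * t * P u v + t ^+ 2 * P v v.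
Proof. by rewrite !(PDl, PZl, real_formDr, real_formZr) [P v u]PC; ring. Qed.

Lemma real_form_cauchy_schwarz u v : P u v ^+ 2 <= P u u * P v v.
Proof. by apply: quad_ge0_discr => // t; rewrite -real_form_line. Qed.

(** Under [P] the vector [u] acts as [f - v]. Testing the hypothesis against [u], [v] and [f]
    replaces the vector identity. *)
Lemma real_form_split f u v : (forall g, P u g + P v g = P f g) ->
  P u u = P f f - 2 * P v f + P v v.
Proof.
move=> uvf; have := uvf u; have := uvf v; have := uvf f.
rewrite (PC v u) (PC f u) (PC f v).
by move: (P u u) (P v v) (P u v) (P u f) (P v f) (P f f) => *; lra.
Qed.

Lemma real_form_sub_ge0 t u v : 0 <= P u u - 2 * t * P u v + t ^+ 2 * P v v.
Proof.
have := P0 (u + rscale (- t) v); rewrite real_form_line.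
by rewrite sqrrN mulrN mulNr.
Qed.

(* Minimize [P u u - 2 * l u]: by the parallelogram law a minimizing sequence is
   Cauchy, and at an almost-minimizer the first variation almost vanishes. *)
Lemma real_form_representation (a b c : R) (l : V -> R) : 0 < a ->
  (forall u, a * hnorm u ^+ 2 <= P u u <= b * hnorm u ^+ 2) ->
  (forall u v, l (u + v) = l u + l v) ->
  (forall t u, l (rscale t u) = t * l u) ->
  (forall u, l u ^+ 2 <= c * P u u) ->
  exists u, forall g, P u g = l g.
Proof.
move=> a0 Pab lD lZ lc.
pose J u := P u u - 2 * l u.
have JE u : J u = P u u - 2 * l u by [].
(* $2\,l(u) \le 2\sqrt{|c| P(u,u)} \le |c| + P(u,u)$, proved by comparing squares. *)
have J_lb u : - `|c| <= J u.
  rewrite /J; have := lc u; have := P0 u; have := ler_norm c.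
  have := normr_ge0 c; move: `|c| (P u u) (l u) => C p x C0 cC p0 xp.
  suff: 2 * x <= C + p by lra.
  have [x0|x0] := leP x 0; first by lra.
  have x20 : 0 <= 2 * x by rewrite mulr_ge0// ltW.
  rewrite -(@ler_pXn2r _ 2) ?nnegrE ?addr_ge0//.
  have := ler_wpM2r p0 cC; have := sqr_ge0 (C - p).
  by rewrite !expr2 in xp *; move: (C * C) => *; lra.
have hJ : has_inf (range J).
  split; first by exists (J 0), 0.
  by exists (- `|c|) => _ [u _ <-].
pose m := inf (range J).
have mJ u : m <= J u by apply: ge_inf; [case: hJ|exists u].
have /choice[u_ Ju] : forall n : nat, exists u, J u < m + n.+1%:R^-1.
  move=> n; have [|_ [u _ <-] Hu] := @inf_adherent _ (range J) n.+1%:R^-1 _ hJ.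
    by rewrite invr_gt0.
  by exists u.
(* $P(v-w,v-w) = 2J(v) + 2J(w) - 4J((v+w)/2)$, and the last value of $J$ is at least $m$. *)
have near_min v w : a * hnorm (v - w) ^+ 2 <= 2 * (J v - m) + 2 * (J w - m).
  have /andP[+ _] := Pab (v - w); move/le_trans; apply.
  have := mJ (rscale (2^-1) (v + w)); rewrite !JE !lZ !lD.
  rewrite -rscaleN1 !(PDl, PZl, real_formDr, real_formZr) [P w v]PC.
  by move: (P v v) (P w w) (P v w) (l v) (l w) => *; lra.
have small (e : R) : 0 < e -> \forall n \near \oo, n.+1%:R^-1 < e.
  by move=> e0; exact: (near_infty_natSinv_lt (PosNum e0)).
have cu : cauchy (u_ @ \oo).
  apply/cauchyP => e e0.
  have eE := ge0_sMk (ltW e0); set r := sRe e in eE.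
  have r0 : 0 < r by have := sRe_lt e0; rewrite sRe0.
  (* [near_min] doubles each of two errors, so errors below a quarter of $a r^2$ suffice. *)
  have d0 : 0 < a * r ^+ 2 / 4 by rewrite divr_gt0// mulr_gt0// exprn_gt0.
  have [N _ HN] := small _ d0.
  exists (u_ N); exists N => //= n Nn.
  rewrite -ball_normE /ball_ /= normE eE sMk_lt.
  rewrite -(@ltr_pXn2r _ 2) ?nnegrE ?hnorm_ge0 ?(ltW r0)// -(ltr_pM2l a0).
  apply: le_lt_trans (near_min _ _) _.
  have := Ju n; have := Ju N; have := HN _ (leqnn N); have := HN _ Nn.
  rewrite /=; move: (a * _) (J _) (J _) n.+1%:R^-1 N.+1%:R^-1 => *; lra.
have /cauchy_cvg cvu := cu.
pose u := lim (u_ @ \oo).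
have close (e : R) : 0 < e -> \forall n \near \oo, hnorm (u - u_ n) < e.
  move=> e0.
  have e0' : 0 < sMk k e 0 by rewrite (@ge0_sMk R k 0)// sRe0 sMk_lt.
  have /cvgrPdist_lt/(_ _ e0') := cvu.
  by apply: filterS => n; rewrite normE sMk_lt.
(* $J(u_n + tg) \ge m > J(u_n) - 1/(n+1)$ for all $t$ makes a quadratic in $t$ nonnegative; this is
   its discriminant bound. *)
have var n g : (P (u_ n) g - l g) ^+ 2 <= n.+1%:R^-1 * P g g.
  apply: quad_ge0_discr => // t.
  have := mJ (u_ n + rscale t g); have := Ju n.
  by rewrite !JE real_form_line lD lZ; move: n.+1%:R^-1 => *; lra.
exists u => g.
pose D := (P u g - l g) ^+ 2.
suff : D <= 0.
  by rewrite real_exprn_even_le0 ?num_real// subr_eq0 => /eqP.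
rewrite leNgt; apply/negP => D0.
(* Split $P(u,g) - l(g)$ at $u_n$ into two terms whose squares are at most $e P(g,g)$, and use
   $(x+y)^2 \le 2x^2 + 2y^2$. *)
have bound e : 0 < e -> D <= 4 * e * P g g.
  move=> e0.
  (* For $h$ the norm of $u - u_n$, the bound 1 gives $h^2 \le h$ and the other bound gives $|b| h
     \le e$. *)
  have r0 : 0 < Num.min 1 (e / (`|b| + 1)).
    by rewrite lt_min ltr01 divr_gt0// ltr_wpDl.
  have [n [en un]] := filter_ex (filterI (small _ e0) (close _ r0)).
  have := real_form_cauchy_schwarz (u - u_ n) g.
  have /andP[_] := Pab (u - u_ n).
  move: un; rewrite lt_min => /andP[h1]; rewrite ltr_pdivlMr ?ltr_wpDl//.
  move: (hnorm_ge0 (u - u_ n)) h1 => h0 h1 hb Pb CS.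
  have be : b * hnorm (u - u_ n) ^+ 2 <= e.
    have := ler_norm b; have := normr_ge0 b.
    move: (`|b|) (hnorm _) h0 h1 hb => B h h0 h1 hb B0 bB.
    apply: (@le_trans _ _ (B * h)); last by nra.
    apply: (@le_trans _ _ (B * h ^+ 2)).
      by rewrite ler_wpM2r// sqr_ge0.
    by rewrite ler_wpM2l// expr2 ler_piMl// ltW.
  have y2 : P (u - u_ n) g ^+ 2 <= e * P g g.
    by apply: le_trans CS _; rewrite ler_wpM2r// (le_trans Pb).
  have x2 : (P (u_ n) g - l g) ^+ 2 <= e * P g g.
    by apply: le_trans (var n g) _; rewrite ler_wpM2r// ltW.
  have -> : D = ((P (u_ n) g - l g) + P (u - u_ n) g) ^+ 2.
    by rewrite real_formBl /D; congr (_ ^+ 2); ring.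
  rewrite -mulrA; move: x2 y2.
  move: (P (u_ n) g - l g) (P (u - u_ n) g) (e * P g g) => x y z.
  by have := sqr_ge0 (x - y); nra.
have g0 := P0 g.
(* This choice turns [bound] into $D \le D\,P(g,g)/(2(P(g,g)+1)) < D$. *)
have e0 : 0 < D / (8 * (P g g + 1)).
  by rewrite divr_gt0// mulr_gt0// ltr_wpDl.
have := bound _ e0.
rewrite (_ : 4 * _ * _ = D * (P g g / (2 * (P g g + 1)))); last first.
  by field; rewrite gt_eqF// ltr_wpDl.
rewrite leNgt => /negP; apply.
rewrite -[ltRHS]mulr1 ltr_pM2l// ltr_pdivrMr ?mulr_gt0 ?ltr_wpDl//.
by lra.
Qed.

End real_forms.

Lemma rdot_separates (R : realType) (k : scalar_kind) (V : hilbertType R k)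
    (u v : V) :
  (forall g, rdot u g = rdot v g) -> u = v.
Proof.
move=> uv; apply/eqP; rewrite -subr_eq0; apply/eqP/hnorm_eq0/eqP.
rewrite -sqrf_eq0 -rdot_hnorm (real_formBl (real_form_rdot V)) uv subrr.
exact: eqxx.
Qed.

(** * Measurability and sums over a countable index type *)

Section measurability.
Context d (X : measurableType d) (R : realType).

Lemma measurable_fun_hnorm (k : scalar_kind) (V : hilbertType R k) (h : X -> V) :
  measurable_fun [set: X] (h : X -> g_sigma_algebraType (@open V)) ->
  measurable_fun [set: X] (fun x => hnorm (h x)).
Proof.
move=> mh; apply: (measurability _ (RGenOInfty.measurableE R)).
move=> _ [_ [r ->]] <-; rewrite setTI.
rewrite (_ : _ @^-1` _ = h @^-1` [set v : V | r < hnorm v]); last first.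
  by apply/seteqP; split=> x /=; rewrite in_itv/= andbT.
rewrite -[X in measurable X]setTI; apply: mh => //.
by apply: sub_sigma_algebra; exact: open_hnorm_gt.
Qed.

(** [pickle] embeds [J] into the naturals, and codes outside its range contribute 0. Results on
    series thereby apply to unordered sums. *)
Lemma esum_countType (J : countType) (a : J -> \bar R) :
  (forall j, 0 <= a j)%E ->
  (\esum_(j in [set: J]) a j = \sum_(n <oo) oapp a 0 (pickle_inv n))%E.
Proof.
move=> a0; have b0 n : (0 <= oapp a 0 (pickle_inv n))%E by case: pickle_inv => /=.
rewrite nneseries_esumT//.
rewrite -[RHS](_ : \esum_(n in range (@pickle J)) oapp a 0 (pickle_inv n) = _)%E.
  rewrite esum_image; last by move=> i j _ _; exact: (pcan_inj pickleK_inv).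
  by apply: eq_esum => j _; rewrite pickleK_inv.
rewrite esum_mkcond; apply: eq_esum => n _.
case: ifPn => // /negP nJ; case E : (pickle_inv n) => [j|//].
by exfalso; apply: nJ; rewrite inE; exists j => //;
  have := @pickle_invK J n; rewrite E.
Qed.

Lemma esumZl (J : countType) (c : R) (a : J -> \bar R) :
  0 <= c -> (forall j, 0 <= a j)%E ->
  (\esum_(j in [set: J]) (c%:E * a j) = c%:E * \esum_(j in [set: J]) a j)%E.
Proof.
move=> c0 a0; rewrite !esum_countType//; last by move=> j; rewrite mule_ge0.
rewrite -nneseriesZl//; last by move=> n _; case: pickle_inv.
by apply: eq_eseriesr => n _; case: pickle_inv => //=; rewrite mule0.
Qed.

Lemma ge0_measurable_esum (J : countType) (D : set X) (a : X -> J -> \bar R) :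
  (forall x j, 0 <= a x j)%E -> (forall j, measurable_fun D (a ^~ j)) ->
  measurable_fun D (fun x => \esum_(j in [set: J]) a x j)%E.
Proof.
move=> a0 ma.
rewrite (_ : (fun x => _) =
    fun x => (\sum_(n <oo | n \in xpredT) oapp (a x) 0 (pickle_inv n))%E).
  apply: ge0_emeasurable_sum => [n x _ _|n _]; first by case: pickle_inv => /=.
  by case: pickle_inv => [j|] /=; [exact: ma|exact: measurable_cst].
by apply/funext => x; rewrite esum_countType.
Qed.

(** With $q = p - m$, one has $q^+ + m = q^- + p$ termwise. Since $q^+ \le p$ and $q^- \le m$, all
    four sums are finite and can be rearranged. *)
Lemma rsum_sub (J : countType) (p m : J -> R) :
  (forall j, 0 <= p j) -> (forall j, 0 <= m j) ->
  (\esum_(j in [set: J]) (p j)%:E < +oo)%E ->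
  (\esum_(j in [set: J]) (m j)%:E < +oo)%E ->
  rsum (fun j => p j - m j) =
    fine (\esum_(j in [set: J]) (p j)%:E) - fine (\esum_(j in [set: J]) (m j)%:E).
Proof.
move=> p0 m0 psum msum.
have le_fin (a b : J -> R) : (forall j, 0 <= a j <= b j) ->
    (\esum_(j in [set: J]) (b j)%:E < +oo)%E ->
    (\esum_(j in [set: J]) (a j)%:E)%E \is a fin_num.
  move=> ab bsum; rewrite ge0_fin_numE; last first.
    by apply: esum_ge0 => j _; rewrite lee_fin; case/andP: (ab j).
  apply: le_lt_trans bsum; apply: le_esum => j _.
  by rewrite lee_fin; case/andP: (ab j).
have pfin := le_fin p p (fun j => introT andP (conj (p0 j) (lexx _))) psum.
have mfin := le_fin m m (fun j => introT andP (conj (m0 j) (lexx _))) msum.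
have posfin : (\esum_(j in [set: J]) ((fun i => p i - m i)^\+ j)%:E)%E
    \is a fin_num.
  apply: le_fin psum => j; rewrite /funrpos le_max lexx orbT/= ge_max p0 andbT.
  by rewrite gerBl.
have negfin : (\esum_(j in [set: J]) ((fun i => p i - m i)^\- j)%:E)%E
    \is a fin_num.
  apply: le_fin msum => j; rewrite /funrneg le_max lexx orbT/= ge_max m0 andbT.
  by rewrite opprB gerBl.
have : (\esum_(j in [set: J]) ((fun i => p i - m i)^\+ j)%:E
    + \esum_(j in [set: J]) (m j)%:E
    = \esum_(j in [set: J]) ((fun i => p i - m i)^\- j)%:E
    + \esum_(j in [set: J]) (p j)%:E)%E.
  rewrite -!esumD => [|j _|j _|j _|j _];
    rewrite ?lee_fin /funrneg /funrpos ?le_max ?lexx ?orbT//.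
  apply: eq_esum => j _; rewrite -!EFinD; congr EFin.
  by case: (leP (p j - m j) 0); case: (leP (- (p j - m j)) 0); lra.
by move/(congr1 fine); rewrite !fineD// /rsum; lra.
Qed.

End measurability.

(** * Energies of the frame and their polarizations *)

Section frame_forms.
Context (R : realType) (k : scalar_kind) (H K : hilbertType R k) (J : countType).
Context (d : measure_display) (X : measurableType d).
Context (mu : {measure set X -> \bar R}) (Ksub : X -> J -> set K).
Context (L : X -> J -> {linear H -> K}).
Context (hL : semicontinuous_gframe mu Ksub L).
Implicit Types (A : set X) (f g h u v w : H).

Definition frame_density f (x : X) : \bar R :=
  (\esum_(j in [set: J]) (hnorm (L x j f) ^+ 2)%:E)%E.

Definition frame_energy A f : R := fine (\int[mu]_(x in A) frame_density f x)%E.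

Lemma frame_density_ge0 f x : (0 <= frame_density f x)%E.
Proof. by apply: esum_ge0 => j _; rewrite lee_fin sqr_ge0. Qed.

Lemma measurable_frame_hnorm f j :
  measurable_fun [set: X] (fun x => hnorm (L x j f) ^+ 2).
Proof.
apply: measurable_funX; apply: measurable_fun_hnorm.
exact: gframe_measurable hL _ _.
Qed.

Lemma measurable_frame_density A f : measurable_fun A (frame_density f).
Proof.
apply: (measurable_funS measurableT) => //.
apply: ge0_measurable_esum => [x j|j]; first by rewrite lee_fin sqr_ge0.
apply/measurable_EFinP; exact: measurable_frame_hnorm.
Qed.

(** The integral over [A] is at most the one over the whole space, which the upper frame bound makes
    finite; so [fine] loses nothing. *)
Lemma integral_frame_density A f : measurable A ->
  (\int[mu]_(x in A) frame_density f x = (frame_energy A f)%:E)%E.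
Proof.
move=> mA; rewrite fineK// ge0_fin_numE; last first.
  by apply: integral_ge0 => x _; exact: frame_density_ge0.
have [a [b [_ _ hab]]] := gframe_bounds hL; have /andP[_ hb] := hab f.
apply: le_lt_trans (ltry (b * hnorm f ^+ 2)); apply: le_trans hb.
apply: ge0_subset_integral => //; first exact: measurable_frame_density.
by move=> x _; exact: frame_density_ge0.
Qed.

Lemma frame_energy_ge0 A f : 0 <= frame_energy A f.
Proof.
by apply: fine_ge0; apply: integral_ge0 => x _; exact: frame_density_ge0.
Qed.

Lemma integrable_frame_density A f :
  measurable A -> mu.-integrable A (frame_density f).
Proof.
move=> mA; apply/integrableP; split; first exact: measurable_frame_density.
under eq_integral do rewrite gee0_abs ?frame_density_ge0//.
by rewrite integral_frame_density// ltry.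
Qed.

Lemma frame_energy_setC A f : measurable A ->
  frame_energy [set: X] f = frame_energy A f + frame_energy (~` A) f.
Proof.
move=> mA; have mAC := measurableC mA; apply: EFin_inj; rewrite EFinD.
rewrite -!integral_frame_density// -(setUv A) ge0_integral_setU//.
- exact: measurable_frame_density.
- by move=> x _; exact: frame_density_ge0.
- exact/disj_setPCl.
Qed.

(** Nonnegative terms allow every interchange of sum and integral. The coefficient is a function of
    the pair, so that one list serves for both the positive and the negative parts of its
    coefficients. *)
Lemma integral_frame_density_sum A (s : seq (R * H)) (c : R * H -> R) :
  measurable A -> (forall p, 0 <= c p) ->
  (\int[mu]_(x in A) (\esum_(j in [set: J])
      (\sum_(p <- s) c p * hnorm (L x j p.2) ^+ 2)%:E)
   = (\sum_(p <- s) c p * frame_energy A p.2)%:E)%E.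
Proof.
move=> mA c0.
under eq_integral => x _.
  under eq_esum => j _ do rewrite -sumEFin.
  rewrite esum_sum; last by move=> j p _ _; rewrite lee_fin mulr_ge0 ?sqr_ge0.
  under eq_bigr => p _.
    under eq_esum do rewrite EFinM.
    rewrite esumZl//; last by move=> j; rewrite lee_fin sqr_ge0.
    over.
  over.
rewrite ge0_integral_sum//; first last.
- by move=> p x _; rewrite mule_ge0// ?lee_fin// frame_density_ge0.
- by move=> p; apply: measurable_funeM; exact: measurable_frame_density.
rewrite -sumEFin; apply: eq_bigr => p _.
rewrite EFinM -integral_frame_density// ge0_integralZl//.
- exact: measurable_frame_density.
- by move=> x _; exact: frame_density_ge0.
- by rewrite lee_fin.
Qed.

(* Splitting the coefficients into positive and negative parts makes all
   quantities nonnegative, so no summability is needed at any point [x]. *)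
Lemma frame_energy_relation A (s : seq (R * H)) : measurable A ->
  (forall x j, \sum_(p <- s) p.1 * hnorm (L x j p.2) ^+ 2 = 0) ->
  \sum_(p <- s) p.1 * frame_energy A p.2 = 0.
Proof.
move=> mA rel.
pose cp (p : R * H) := Num.max p.1 0; pose cn (p : R * H) := Num.max (- p.1) 0.
have cE p : p.1 = cp p - cn p.
  by rewrite /cp /cn; case: (leP p.1 0); case: (leP (- p.1) 0); lra.
have split_sum (F : H -> R) : \sum_(p <- s) p.1 * F p.2 =
    \sum_(p <- s) cp p * F p.2 - \sum_(p <- s) cn p * F p.2.
  by rewrite -sumrB; apply: eq_bigr => p _; rewrite -mulrBl -cE.
rewrite split_sum; apply/eqP; rewrite subr_eq0; apply/eqP/EFin_inj.
rewrite -!integral_frame_density_sum//; first last.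
- by move=> p; rewrite le_max lexx orbT.
- by move=> p; rewrite le_max lexx orbT.
apply: eq_integral => x _; apply: eq_esum => j _; congr EFin.
by apply/eqP; rewrite -subr_eq0 -(split_sum (fun u => hnorm (L x j u) ^+ 2)) rel.
Qed.

Lemma op_rscale x j t u : L x j (rscale t u) = rscale t (L x j u).
Proof. exact: linearZ. Qed.

(** Real polarization, with the factor $1/4$ moved inside the quadratic form as $1/2$ on the
    vectors. *)
Definition frame_pairing A f g : R :=
  frame_energy A (rscale 2^-1 (f + g)) - frame_energy A (rscale 2^-1 (f - g)).

Let expand_rdot := (@rdotDl R k K, @rdotZl R k K,
  real_formDr (real_form_rdot K), real_formZr (real_form_rdot K)).

Lemma frame_pairing_diag A u : measurable A ->
  frame_pairing A u u = frame_energy A u.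
Proof.
move=> mA; apply/eqP; rewrite -subr_eq0 /frame_pairing.
(* The list encodes left side minus right side as coefficient-vector pairs; the same combination of
   squared norms in [K] must then vanish at each [x], [j]. *)
have := @frame_energy_relation A [:: (1, rscale 2^-1 (u + u));
  (-1, rscale 2^-1 (u - u)); (-1, u)] mA _.
rewrite !big_cons big_nil /= => <-; first by apply/eqP; ring.
move=> x j; rewrite !big_cons big_nil /= -!rdot_hnorm.
rewrite -!rscaleN1 !(linearD, op_rscale) !expand_rdot.
by field.
Qed.

(** Each law is a linear relation among energies that already holds for the squared norm of [K], so
    [frame_energy_relation] transfers it. *)
Lemma frame_pairing_form A : measurable A -> real_form (frame_pairing A).
Proof.
move=> mA; split=> [u v|u v w|t u v|u].
- apply/eqP; rewrite -subr_eq0 /frame_pairing.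
  have := @frame_energy_relation A [:: (1, rscale 2^-1 (u + v));
    (-1, rscale 2^-1 (u - v)); (-1, rscale 2^-1 (v + u));
    (1, rscale 2^-1 (v - u))] mA _.
  rewrite !big_cons big_nil /= => <-; first by apply/eqP; ring.
  move=> x j; rewrite !big_cons big_nil /= -!rdot_hnorm.
  by rewrite -!rscaleN1 !(linearD, op_rscale) !expand_rdot; field.
- apply/eqP; rewrite -subr_eq0 /frame_pairing.
  have := @frame_energy_relation A [:: (1, rscale 2^-1 (u + v + w));
    (-1, rscale 2^-1 (u + v - w)); (-1, rscale 2^-1 (u + w));
    (1, rscale 2^-1 (u - w)); (-1, rscale 2^-1 (v + w));
    (1, rscale 2^-1 (v - w))] mA _.
  rewrite !big_cons big_nil /= => <-; first by apply/eqP; ring.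
  move=> x j; rewrite !big_cons big_nil /= -!rdot_hnorm.
  rewrite -!rscaleN1 !(linearD, op_rscale) !expand_rdot.
  rewrite [rdot (L x j w) (L x j u)]rdotC [rdot (L x j w) (L x j v)]rdotC.
  by rewrite [rdot (L x j v) (L x j u)]rdotC; field.
- apply/eqP; rewrite -subr_eq0 /frame_pairing.
  have := @frame_energy_relation A [:: (1, rscale 2^-1 (rscale t u + v));
    (-1, rscale 2^-1 (rscale t u - v)); (- t, rscale 2^-1 (u + v));
    (t, rscale 2^-1 (u - v))] mA _.
  rewrite !big_cons big_nil /= => <-; first by apply/eqP; ring.
  move=> x j; rewrite !big_cons big_nil /= -!rdot_hnorm.
  rewrite -!rscaleN1 !(linearD, op_rscale) !expand_rdot.
  by rewrite [rdot (L x j v) (L x j u)]rdotC; field.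
- by rewrite frame_pairing_diag// frame_energy_ge0.
Qed.

(** Polarize in [K] at each [x], [j]. Both densities are integrable, hence finite almost everywhere,
    and there [rsum_sub] applies; the default values of [rsum] occur only on a null set. *)
Lemma frame_pairingE A u v : measurable A ->
  \int[mu]_(x in A) rsum (fun j => rdot (L x j u) (L x j v)) =
  frame_pairing A u v.
Proof.
move=> mA; rewrite /Rintegral /frame_pairing.
set p := rscale 2^-1 (u + v); set m := rscale 2^-1 (u - v).
have rdotE x j : rdot (L x j u) (L x j v) =
    hnorm (L x j p) ^+ 2 - hnorm (L x j m) ^+ 2.
  rewrite /p /m -!rdot_hnorm -!rscaleN1 !(linearD, op_rscale) !expand_rdot.
  by rewrite [rdot (L x j v) (L x j u)]rdotC; field.
transitivity (fine (\int[mu]_(x in A) (frame_density p \- frame_density m) x)%E).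
  congr fine; apply: ae_eq_integral => //.
  - rewrite /rsum; apply/measurable_EFinP; apply: measurable_funB.
      apply: measurableT_comp; first exact: fine_measurable.
      apply: ge0_measurable_esum => [x j|j].
        by rewrite lee_fin /funrpos le_max lexx orbT.
      apply/measurable_EFinP; apply: measurable_maxr => //.
      under eq_fun do rewrite rdotE.
      apply: (measurable_funS measurableT) => //.
      by apply: measurable_funB; exact: measurable_frame_hnorm.
    apply: measurableT_comp; first exact: fine_measurable.
    apply: ge0_measurable_esum => [x j|j].
      by rewrite lee_fin /funrneg le_max lexx orbT.
    apply/measurable_EFinP; apply: measurable_maxr => //.
    apply: measurableT_comp => //; under eq_fun do rewrite rdotE.
    apply: (measurable_funS measurableT) => //.
    by apply: measurable_funB; exact: measurable_frame_hnorm.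
  - by apply: emeasurable_funB; exact: measurable_frame_density.
  - have := integrable_ae mA (integrable_frame_density p mA).
    have := integrable_ae mA (integrable_frame_density m mA).
    apply: filterS2 => x mfin pfin Ax; have := mfin Ax; have := pfin Ax.
    move=> px mx; under eq_fun do rewrite rdotE.
    rewrite rsum_sub; first last.
    - by move: mx; rewrite ge0_fin_numE// frame_density_ge0.
    - by move: px; rewrite ge0_fin_numE// frame_density_ge0.
    - by move=> j; rewrite sqr_ge0.
    - by move=> j; rewrite sqr_ge0.
    by rewrite EFinB !fineK.
rewrite integralB//; try exact: integrable_frame_density.
by rewrite !integral_frame_density//.
Qed.

Lemma gframe_formE A f g : measurable A ->
  gframe_form mu L A f g =
  sMk k (frame_pairing A f g) (frame_pairing A f (sMk k 0 1 *: g)).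
Proof.
move=> mA; rewrite -!frame_pairingE// /gframe_form /Defs.sintegral /ssum.
(* Over the reals [sIm (sMk k a b)] is 0 rather than [b], but there the outer [sMk] discards its
   second argument. *)
have sMk_sIm (a : R) (p q : X -> R) :
    sMk k a (\int[mu]_(x in A) sIm (sMk k (p x) (q x)))
    = sMk k a (\int[mu]_(x in A) q x) by case: k.
rewrite sMk_sIm; congr (sMk k _ _).
  by under eq_Rintegral do rewrite sReK.
congr Rintegral; apply/funext => x; congr rsum; apply/funext => j.
by rewrite sIm_inner linearZ.
Qed.

Lemma frame_pairing_setC A u v : measurable A ->
  frame_pairing [set: X] u v = frame_pairing A u v + frame_pairing (~` A) u v.
Proof.
by move=> mA; rewrite /frame_pairing !(frame_energy_setC _ mA); ring.
Qed.

Lemma frame_energy_le A u : measurable A ->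
  frame_energy A u <= frame_energy [set: X] u.
Proof. by move=> mA; rewrite (frame_energy_setC u mA) lerDl frame_energy_ge0. Qed.

Lemma frame_energy_bounds : exists a b : R, 0 < a /\
  forall u, a * hnorm u ^+ 2 <= frame_energy [set: X] u <= b * hnorm u ^+ 2.
Proof.
have [a [b [a0 _ hab]]] := gframe_bounds hL; exists a, b; split=> // u.
by have := hab u; rewrite (integral_frame_density u measurableT) !lee_fin.
Qed.

(** Bounds the functional $P_A(u, \cdot)$ by the coercive form $P_X$, as the representation theorem
    requires. *)
Lemma frame_pairing_cauchy_schwarz A u v : measurable A ->
  frame_pairing A u v ^+ 2 <= frame_energy A u * frame_energy [set: X] v.
Proof.
move=> mA; apply: le_trans (real_form_cauchy_schwarz (frame_pairing_form mA) u v) _.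
by rewrite !frame_pairing_diag// ler_wpM2l ?frame_energy_ge0 ?frame_energy_le.
Qed.

Lemma rdot_gframe_op A f g : measurable A ->
  rdot (gframe_op mu L A f) g = frame_pairing A f g.
Proof.
move=> mA; have Pform := frame_pairing_form mA.
have [a [b [_ hab]]] := frame_energy_bounds.
have [h hh] : exists h, forall g, rdot h g = frame_pairing A f g.
  apply: (@real_form_representation _ _ _ _ (real_form_rdot H) 1 1
    (frame_energy A f * b)) => // [u|u v|t u|u].
  - by rewrite rdot_hnorm !mul1r lexx.
  - exact: real_formDr.
  - exact: real_formZr.
  - apply: le_trans (frame_pairing_cauchy_schwarz f u mA) _.
    rewrite -mulrA ler_wpM2l ?frame_energy_ge0// rdot_hnorm.
    by have /andP[] := hab u.
suff /(congr1 (@sRe R k)) : inner (gframe_op mu L A f) g = gframe_form mu L A f g.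
  by rewrite gframe_formE// sReK.
(* By [innerE] the real representer [h] also represents the scalar-valued form, so the default of
   [xget] is excluded. *)
rewrite /gframe_op; case: xgetP => [y _|/(_ h)[]]; first exact.
by move=> g'; rewrite innerE gframe_formE// !hh.
Qed.

(** Representing $P_A(f, \cdot)$ through the coercive form $P_X$ gives a preimage of $S_A f$ under
    $S$; hence $S S^{-1} S_A f = S_A f$. *)
Lemma frame_pairing_gframe_inv A f g : measurable A ->
  frame_pairing [set: X] (gframe_inv mu L (gframe_op mu L A f)) g =
  frame_pairing A f g.
Proof.
move=> mA; have [a [b [a0 hab]]] := frame_energy_bounds.
have TForm := frame_pairing_form measurableT.
have [u hu] : exists u, forall g,
    frame_pairing [set: X] u g = frame_pairing A f g.
  apply: (@real_form_representation _ _ _ _ TForm a b (frame_energy A f)) => //.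
  - by move=> u; rewrite frame_pairing_diag.
  - exact: real_formDr (frame_pairing_form mA) f.
  - by move=> t u; exact: real_formZr (frame_pairing_form mA) t f u.
  - move=> u; rewrite frame_pairing_diag//.
    exact: frame_pairing_cauchy_schwarz.
rewrite -(rdot_gframe_op _ _ measurableT) -(rdot_gframe_op _ _ mA).
rewrite /gframe_inv pinvK //.
apply/mem_set; exists u; first exact: I.
apply: rdot_separates => h.
exact: etrans (rdot_gframe_op u h measurableT)
  (etrans (hu h) (esym (rdot_gframe_op f h mA))).
Qed.

End frame_forms.

(** * The energy identity and the lower bound *)

Theorem theorem3p7 (R : realType) (k : scalar_kind) (H K : hilbertType R k)
    (J : countType) (d : measure_display) (X : measurableType d)
    (mu : {measure set X -> \bar R})
    (Ksub : X -> J -> set K)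
    (hKsub : forall x j, closed_subspace (Ksub x j))
    (L : X -> J -> {linear H -> K})
    (hL : semicontinuous_gframe mu Ksub L)
    (lambda : R) (hlambda : 0 <= lambda <= 1)
    (X1 : set X) (mX1 : measurable X1) (f : H) :
  ((\int[mu]_x \esum_(j in [set: J])
      (hnorm (canonical_dual mu L x j (gframe_op mu L X1 f)) ^+ 2)%:E)
   + (\int[mu]_(x in ~` X1) \esum_(j in [set: J]) (hnorm (L x j f) ^+ 2)%:E)
   = (\int[mu]_x \esum_(j in [set: J])
      (hnorm (canonical_dual mu L x j (gframe_op mu L (~` X1) f)) ^+ 2)%:E)
   + (\int[mu]_(x in X1) \esum_(j in [set: J]) (hnorm (L x j f) ^+ 2)%:E))%E
  /\
  ((\int[mu]_x \esum_(j in [set: J])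
      (hnorm (canonical_dual mu L x j (gframe_op mu L (~` X1) f)) ^+ 2)%:E)
   + (\int[mu]_(x in X1) \esum_(j in [set: J]) (hnorm (L x j f) ^+ 2)%:E)
   >= (2 * lambda - lambda ^+ 2)%:E
      * (\int[mu]_(x in X1) \esum_(j in [set: J]) (hnorm (L x j f) ^+ 2)%:E)
    + (1 - lambda ^+ 2)%:E
      * (\int[mu]_(x in ~` X1) \esum_(j in [set: J])
           (hnorm (L x j f) ^+ 2)%:E))%E.
Proof.
have mX2 := measurableC mX1.
set u1 := gframe_inv mu L (gframe_op mu L X1 f).
set u2 := gframe_inv mu L (gframe_op mu L (~` X1) f).
pose Phi := frame_energy mu L.
pose P := frame_pairing mu L [set: X].
have PT : real_form P by exact: (frame_pairing_form hL measurableT).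
have Pdiag u : P u u = Phi [set: X] u by exact: (frame_pairing_diag hL).
have Phi_split u : Phi [set: X] u = Phi X1 u + Phi (~` X1) u.
  exact: (frame_energy_setC hL).
have P1 g : P u1 g = frame_pairing mu L X1 f g.
  exact: (frame_pairing_gframe_inv hL).
have P2 g : P u2 g = frame_pairing mu L (~` X1) f g.
  exact: (frame_pairing_gframe_inv hL).
have P2f : P u2 f = Phi (~` X1) f by rewrite P2 (frame_pairing_diag hL).
have intE A u : measurable A -> (\int[mu]_(x in A)
    \esum_(j in [set: J]) (hnorm (L x j u) ^+ 2)%:E)%E = (Phi A u)%:E.
  exact: (integral_frame_density hL).
(* By definition of the dual, the integrand is the frame density of $S^{-1} S_A f$. *)
have dualE A : (\int[mu]_x \esum_(j in [set: J])
    (hnorm (canonical_dual mu L x j (gframe_op mu L A f)) ^+ 2)%:E)%E =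
    (Phi [set: X] (gframe_inv mu L (gframe_op mu L A f)))%:E.
  exact: intE measurableT.
have energy1 : Phi [set: X] u1 = Phi [set: X] f - 2 * P u2 f + Phi [set: X] u2.
  have sum12 g : P u1 g + P u2 g = P f g.
    by rewrite P1 P2 /P (frame_pairing_setC hL _ _ mX1).
  by have := real_form_split PT sum12; rewrite !Pdiag.
(* Once $\Phi_{X_1}(f)$ is added, the coefficients become $1 - (1-\lambda)^2 = 2\lambda - \lambda^2$
   on $X_1$ and $2(1-\lambda) - (1-\lambda)^2 = 1 - \lambda^2$ on its complement. *)
have energy2 : 0 <= Phi [set: X] u2 - 2 * (1 - lambda) * P u2 f
    + (1 - lambda) ^+ 2 * Phi [set: X] f.
  by have := real_form_sub_ge0 PT (1 - lambda) u2 f; rewrite !Pdiag.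
have final (i1 i2 j1 j2 : \bar R) :
    i1 = (Phi [set: X] u1)%:E -> i2 = (Phi [set: X] u2)%:E ->
    j1 = (Phi X1 f)%:E -> j2 = (Phi (~` X1) f)%:E ->
    (i1 + j2 = i2 + j1)%E /\
    ((2 * lambda - lambda ^+ 2)%:E * j1 + (1 - lambda ^+ 2)%:E * j2
      <= i2 + j1)%E.
  move: energy1 energy2; rewrite P2f (Phi_split f).
  move: (Phi X1 f) (Phi (~` X1) f) (Phi [set: X] u1) (Phi [set: X] u2).
  move=> a1 a2 b1 b2 -> energy2 -> -> -> ->.
  split; first by rewrite -!EFinD; congr EFin; ring.
  rewrite -!EFinM -!EFinD lee_fin; move: energy2; clear; lra.
exact: final (dualE X1) (dualE (~` X1)) (intE X1 f mX1) (intE (~` X1) f mX2).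
Qed.
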